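(* Let $k\geq 2$ be an integer and let $\mathbf{n}=(n_1,n_2)$ with $n_1,n_2$ positive integers. Let $\mu_k(\mathbf{n})$ denote the maximum size of a subset $S\subseteq [n_1]\times[n_2]$ such that there are no elements $\mathbf{a}_1,\ldots,\mathbf{a}_k\in S$ (not necessarily distinct) with $\mathbf{a}_1+\cdots+\mathbf{a}_k=\mathbf{n}$, and let $\nu_k(\mathbf{n})=\mu_k(\mathbf{n})/(n_1n_2)$. Then, as both $n_1$ and $n_2$ go to infinity, \[\nu_k(\mathbf{n})=\frac{k^2-2}{k^2}+O\left(\frac{1}{\min\{n_1,n_2\}}\right).\]
   Context: For a positive integer $n$, $[n]=\{1,\ldots,n\}$. Addition of lattice points is coordinatewise. The implied constant in $O(\cdot)$ may depend on $k$. *)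

(* Defs.v *)
From mathcomp Require Import all_boot all_order all_algebra.
From mathcomp Require Import reals.

Set Implicit Arguments.
Unset Strict Implicit.
Unset Printing Implicit Defensive.

Import Order.TTheory GRing.Theory Num.Theory.

(* Points of {0,..,n1} x {0,..,n2}: the ordinals carry the actual coordinates,
   without a shift, and [grid n1 n2] keeps the points of [n1] x [n2]. *)
Definition pt (n1 n2 : nat) : finType := ('I_n1.+1 * 'I_n2.+1)%type.

Definition grid (n1 n2 : nat) : {set pt n1 n2} :=
  [set p : pt n1 n2 | (0 < p.1)%N && (0 < p.2)%N].

Definition sums_to_n (k n1 n2 : nat) (a : 'I_k -> pt n1 n2) : bool :=
  ((\sum_(i < k) (a i).1)%N == n1) && ((\sum_(i < k) (a i).2)%N == n2).

Definition admissible (k n1 n2 : nat) (S : {set pt n1 n2}) : bool :=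
  ~~ [exists a : {ffun 'I_k -> pt n1 n2},
        [forall i, a i \in S] && sums_to_n a].

Definition mu (k n1 n2 : nat) : nat :=
  (\max_(S : {set pt n1 n2} | (S \subset grid n1 n2) && admissible k S) #|S|)%N.

Definition nu (R : realType) (k n1 n2 : nat) : R :=
  ((mu k n1 n2)%:R / (n1%:R * n2%:R))%R.

(* Main.v *)
Require Import Defs.
From mathcomp Require Import all_boot all_order all_algebra.
From mathcomp Require Import reals.
From mathcomp Require Import zify ring lra.

(** Lower bound: delete from the grid the triangle [x / n1 + y / n2 <= 2 / k],
    which has at most [2 n1 n2 / k ^ 2] lattice points; the remaining points
    have [x / n1 + y / n2 > 2 / k], so [k] of them never add up to [(n1, n2)].

    Upper bound: cut [S] into rows.  If [n] is not in [A_1 + ... + A_k], the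
    sets [A_i] together omit at least [n - (k - 1)] points of [[1, n]].  So any
    [k] rows whose heights add up to [n2] together omit about [n1] points.
    Average this over about [2 n2 / k] choices of the heights such that each of
    the [k] heights runs injectively through [[1, 2 n2 / k]]: the average
    height is then [n2 / k], as needed, and [S] omits about
    [(2 n2 / k) n1 / k] points. *)

Set Implicit Arguments.
Unset Strict Implicit.
Unset Printing Implicit Defensive.

Import Order.TTheory GRing.Theory Num.Theory.

(** * Gaps in sumsets of integers *)

Definition gaps (A : pred nat) (n : nat) : nat := \sum_(1 <= x < n.+1) ~~ A x.

(* [A 0 + ... + A j], with positive summands from [A 1], ..., [A j].  The
   recursion cannot start at the empty sum, which misses every [m > 0]:
   [gaps_sumset] would fail for it. *)
Fixpoint sumset (A : nat -> pred nat) (j : nat) : pred nat :=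
  if j is j'.+1 then
    fun m => has (fun x => A j x && sumset A j' (m - x)) (index_iota 1 m)
  else A 0.

Lemma gapsS A n : gaps A n.+1 = gaps A n + ~~ A n.+1.
Proof. by rewrite /gaps big_nat_recr. Qed.

Lemma gaps_le A n : gaps A n <= n.
Proof.
elim: n => [|n IH]; first by rewrite /gaps big_geq.
by rewrite gapsS; case: (A _) => /=; lia.
Qed.

(* [x |-> n - x] maps the elements of [A] below [n] into the gaps of [B]. *)
Lemma gaps_add (A B : pred nat) n :
  (forall x, 0 < x < n -> ~~ (A x && B (n - x))) ->
  n <= gaps A n + gaps B n + 1.
Proof.
case: n => [//|n] hAB; rewrite !gapsS.
suff : n <= gaps A n + gaps B n by lia.
have -> : gaps B n = \sum_(1 <= x < n.+1) ~~ B (n.+1 - x).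
  rewrite /gaps big_nat_rev /=; apply: eq_bigr => x _.
  by rewrite add1n subSS.
rewrite -big_split /= -[leqLHS](subn1 n.+1) -[leqLHS]muln1 -sum_nat_const_nat.
rewrite big_nat_cond [leqRHS]big_nat_cond; apply: leq_sum => x.
rewrite andbT => /andP[x0 xn].
have /hAB : 0 < x < n.+1 by lia.
by case: (A x); case: (B _).
Qed.

Lemma sumset_gap_le A j n : ~~ sumset A j.+1 n ->
  n <= gaps (A j.+1) n + gaps (sumset A j) n + 1.
Proof.
move=> /hasPn hn; apply: gaps_add => x x0.
by apply: hn; rewrite mem_index_iota.
Qed.

(* The number of gaps is at most the largest gap, to which [sumset_gap_le]
   applies. *)
Lemma gaps_sumset A j n :
  gaps (sumset A j) n <= \sum_(i < j.+1) gaps (A i) n + j.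
Proof.
elim: j n => [|j IHj] n; first by rewrite big_ord1 addn0.
elim: n => [|n IHn]; first by rewrite {1}/gaps big_geq.
case hS: (sumset A j.+1 n.+1).
  rewrite gapsS hS addn0; apply: leq_trans IHn _.
  by rewrite leq_add2r; apply: leq_sum => i _; rewrite gapsS leq_addr.
apply: leq_trans (gaps_le _ _) _.
have := sumset_gap_le (negbT hS); have := IHj n.+1.
by rewrite (big_ord_recr j.+1) /=; lia.
Qed.

Lemma gap_sumset_le A j n : ~~ sumset A j.+1 n ->
  n <= \sum_(i < j.+2) gaps (A i) n + j.+1.
Proof.
move=> /sumset_gap_le; have := gaps_sumset A j n.
by rewrite (big_ord_recr j.+1) /=; lia.
Qed.

Lemma sumsetP A j n : sumset A j n ->
  exists2 x : nat -> nat,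
    forall i, i <= j -> A i (x i) & \sum_(i < j.+1) x i = n.
Proof.
elim: j n => [|j IH] n /=.
  move=> An; exists (fun=> n); last by rewrite big_ord1.
  by move=> i; rewrite leqn0 => /eqP->.
move=> /hasP[a]; rewrite mem_index_iota => /andP[_ an] /andP[Aa /IH[x Ax xs]].
exists (fun i => if i == j.+1 then a else x i).
  by move=> i ij; case: eqP => [->//|/eqP ne]; apply: Ax; lia.
rewrite big_ord_recr /= eqxx (eq_bigr (fun i : 'I_j.+1 => x i)) ?xs; first lia.
by move=> i _; have := ltn_ord i; case: eqP => // ->; rewrite ltnn.
Qed.

(** * Injective slots with constant sum, and elementary estimates *)

(** The slots [t] and [h.*2 - t] balance each other, so induction in steps of two leaves only
    [k = 2] and [k = 3]. *)
Lemma balanced_slots k h : 2 <= k -> exists f : nat -> nat -> nat,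
  (forall i, i < k -> {in gtn h.*2.+1 &, injective (f i)}) /\
  (forall t, t <= h.*2 -> \sum_(i < k) f i t = k * h).
Proof.
elim/ltn_ind: k => -[|[|[|[|k]]]] IH // _.
- exists (fun i t => if i is 0 then t else h.*2 - t); split.
  + by case=> [|i] _ t u; rewrite !inE /=; lia.
  + by move=> t tl; rewrite !big_ord_recr big_ord0 /=; lia.
- (* [t + s t] runs through [[h, 3 h]]: the values of parity [h] come from
     [t <= h], the others from [t > h]. *)
  pose s t := if t <= h then t + h else t - h.+1.
  exists (fun i t => match i with 0 => t | 1 => s t | _ => 3 * h - (t + s t) end).
  split.
  + by case=> [|[|i]] _ t u; rewrite !inE /= /s;
      case: (leqP t h); case: (leqP u h); lia.
  + by move=> t tl; rewrite !big_ord_recr big_ord0 /= /s; case: (leqP t h); lia.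
have [//|//|f [fi fs]] := IH k.+2.
exists (fun i t => match i with 0 => t | 1 => h.*2 - t | i'.+2 => f i' t end).
split.
- case=> [|[|i]] ik; [by move=> t u; rewrite !inE /=; lia.. | exact: fi].
- by move=> t tl; rewrite 2!big_ord_recl /= fs //; lia.
Qed.

Lemma sum_injective_le (g f : nat -> nat) M n :
  {in gtn M &, injective f} -> (forall t, t < M -> 0 < f t <= n) ->
  \sum_(t < M) g (f t) <= \sum_(1 <= y < n.+1) g y.
Proof.
move=> fi fb; rewrite -(big_mkord xpredT (fun t => g (f t))) -(big_map f xpredT g).
apply: uniq_sub_le_big => //=.
- by move=> x y; apply: leq_addr.
- rewrite map_inj_in_uniq ?iota_uniq // => t u.
  by rewrite !mem_index_iota /= => ? ?; apply: fi.
- exact: iota_uniq.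
move=> y /mapP[t]; rewrite !mem_index_iota /= => tM ->.
by rewrite ltnS; apply: fb.
Qed.

(** The squares telescope: [2 * k * (u - k) + (u - k) ^ 2 = u ^ 2 - k ^ 2] for
    [u = L - k * m >= k]. *)
Lemma sum_truncated_le k L m :
  2 * k * \sum_(1 <= x < m.+1) (L - k * x) + (L - k * m) ^ 2 <= L ^ 2.
Proof.
elim: m => [|m IH]; first by rewrite big_geq //; lia.
rewrite big_nat_recr //= mulnDr mulnS.
apply: leq_trans IH; rewrite -addnA leq_add2l.
have -> : L - (k + k * m) = (L - k * m) - k by lia.
by move: (L - k * m) => u; case: (leqP k u); nia.
Qed.

Lemma count_affine_le a b c m :
  c * \sum_(1 <= y < m.+1) (a + c * y <= b) <= b - a.
Proof.
(* The bound [c * m] closes the induction when [m.+1] is counted, since then [c * m.+1 <= b - a]. *)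
have : c * \sum_(1 <= y < m.+1) (a + c * y <= b) <= minn (c * m) (b - a).
  elim: m => [|m IH]; first by rewrite big_geq // muln0.
  by rewrite big_nat_recr //= mulnDr mulnS; case: leqP => /=; lia.
by move=> /leq_trans; apply; exact: geq_minr.
Qed.

(** * Rows of a planar set *)

(* Meaningful only for [x <= n1] and [y <= n2]: otherwise [inord] is [0]. *)
Definition row (n1 n2 : nat) (S : {set pt n1 n2}) (y : nat) : pred nat :=
  fun x => ((inord x, inord y) : pt n1 n2) \in S.

Lemma card_rows n1 n2 (S : {set pt n1 n2}) : S \subset grid n1 n2 ->
  #|S| = \sum_(1 <= y < n2.+1) \sum_(1 <= x < n1.+1) row S y x.
Proof.
move=> /subsetP hS.
have row0 x y : x <= n1 -> y <= n2 -> (x == 0) || (y == 0) -> row S y x = false.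
  move=> xn yn xy; apply/negP => /hS; rewrite inE /= !inordK ?ltnS //; lia.
have -> : #|S| = \sum_(0 <= y < n2.+1) \sum_(0 <= x < n1.+1) row S y x.
  rewrite -sum1_card big_mkcond /=.
  rewrite (eq_bigr (fun p : pt n1 n2 => (p.1, p.2) \in S : nat)); last first.
    by case=> x y _ /=; case: (_ \in S).
  rewrite -(pair_bigA _ (fun x y => ((x, y) : pt n1 n2) \in S : nat)) /=.
  rewrite exchange_big /= big_mkord.
  apply: eq_bigr => y _; rewrite big_mkord; apply: eq_bigr => x _.
  by rewrite /row !inord_val.
rewrite big_ltn // big_nat big1 ?add0n; last first.
  by move=> x xn; rewrite row0 ?orbT //.
apply: eq_big_nat => y /andP[y0 yn].
by rewrite big_ltn // row0.
Qed.

Lemma card_gaps n1 n2 (S : {set pt n1 n2}) : S \subset grid n1 n2 ->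
  #|S| + \sum_(1 <= y < n2.+1) gaps (row S y) n1 = n1 * n2.
Proof.
move=> hS; rewrite card_rows // -big_split /=.
rewrite (eq_bigr (fun=> n1)) ?sum_nat_const_nat ?subn1 1?mulnC // => y _.
rewrite /gaps -big_split /= (eq_bigr (fun=> 1)); last by move=> x _; case: row.
by rewrite sum_nat_const_nat subn1 muln1.
Qed.

(** If [n1] lay in the sumset of these rows, its summands paired with the heights [y i] would be [k]
    points of [S] with sum [(n1, n2)]. *)
Lemma admissible_gaps k n1 n2 (S : {set pt n1 n2}) (y : nat -> nat) :
  2 <= k -> admissible k S -> \sum_(i < k) y i = n2 ->
  n1 <= \sum_(i < k) gaps (row S (y i)) n1 + k.-1.
Proof.
case: k => [|[|k]] // _ hS ys.
apply: (@gap_sumset_le (fun i => row S (y i))).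
apply: contra hS => /sumsetP[x xS xs].
(* Keeps every coordinate in the range where [inord] is faithful. *)
have le_sum (z : nat -> nat) (i : 'I_k.+2) : z i <= \sum_(j < k.+2) z j.
  by rewrite (bigD1 i) //= leq_addr.
apply/existsP; exists [ffun i : 'I_k.+2 => (inord (x i), inord (y i))].
apply/andP; split.
  by apply/forallP => i; rewrite ffunE; apply: xS; rewrite -ltnS.
apply/andP; split; apply/eqP; [rewrite -[RHS]xs | rewrite -[RHS]ys];
  apply: eq_bigr => i _; rewrite ffunE /= inordK // ltnS.
- by rewrite -xs le_sum.
- by rewrite -ys le_sum.
Qed.

(** * Upper bound for [mu] *)

Lemma admissible_card_le k n1 n2 (S : {set pt n1 n2}) :
  2 <= k <= n2 -> S \subset grid n1 n2 -> admissible k S ->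
  k ^ 2 * #|S| + 2 * (n1 * n2) <= k ^ 2 * (n1 * n2) + 3 * k * n1 + 2 * k * n2.
Proof.
move=> /andP[k2 kn] Sg aS; have /esym := card_gaps Sg.
set G := \sum_(1 <= y < _) _ => cardS.
have [h hq] : exists h, n2 %/ k = h.+1.
  by exists (n2 %/ k).-1; rewrite prednK // divn_gt0 //; lia.
set r := n2 %% k.
have n2E : n2 = k * h.+1 + r by rewrite [LHS](divn_eq n2 k) hq mulnC.
have [f [fi fs]] := balanced_slots h k2.
(* The shift by one makes heights positive, with sum [k * h.+1]; adding [r] to slot [0] completes
   the sum to [n2] and preserves injectivity. *)
pose g i t := (f i t).+1 + (if i == 0 then r else 0).
have gs t : t <= h.*2 -> \sum_(i < k) g i t = n2.
  move=> th; rewrite /g big_split /= -big_mkcond /=.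
  have -> : \sum_(i < k | i == 0 :> nat) r = r.
    by rewrite (big_pred1 (Ordinal (ltnW k2))).
  under eq_bigr do rewrite -addn1.
  by rewrite big_split /= fs // sum_nat_const card_ord n2E; lia.
have gG i : i < k -> \sum_(t < h.*2.+1) gaps (row S (g i t)) n1 <= G.
  move=> ik; apply: (@sum_injective_le (fun y => gaps (row S y) n1)).
    by move=> t u ht hu /addIn[]; apply: fi.
  move=> t ht; rewrite {1}/g addSn /= -(gs t) // (bigD1 (Ordinal ik)) //=.
  exact: leq_addr.
have : h.*2.+1 * n1 <= k * G + h.*2.+1 * k.-1.
  rewrite -[X in X * n1 <= _]card_ord -[X in _ + X * _]card_ord -!sum_nat_const.
  apply: (@leq_trans (\sum_(t < h.*2.+1)
                        (\sum_(i < k) gaps (row S (g i t)) n1 + k.-1))).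
    apply: leq_sum => t _; apply: (@admissible_gaps _ _ _ _ (g^~ t)) => //.
    by apply: gs; rewrite -ltnS.
  rewrite big_split /= leq_add2r exchange_big /= -[X in _ <= X * G]card_ord.
  by rewrite -sum_nat_const; apply: leq_sum => i _; apply: gG.
have rk : r < k by rewrite ltn_mod; lia.
have -> : k ^ 2 * (n1 * n2) = k ^ 2 * #|S| + k ^ 2 * G by rewrite cardS mulnDr.
move: (#|S|) rk => s rk hG.
have : k * h.*2.+1 * n1 <= k ^ 2 * G + k * h.*2.+1 * k.-1.
  by rewrite -mulnA (leq_trans (leq_mul (leqnn k) hG)) // mulnDr !mulnA.
have : k * h.*2.+1 * k.-1 <= 2 * k * n2 by nia.
(* Here [2 * n2 = k * h.*2.+1 + k + 2 * r] with [r < k]. *)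
have : 2 * (n1 * n2) <= k * h.*2.+1 * n1 + 3 * k * n1 by nia.
by lia.
Qed.

Lemma mu_le k n1 n2 : 2 <= k <= n2 ->
  k ^ 2 * mu k n1 n2 + 2 * (n1 * n2)
    <= k ^ 2 * (n1 * n2) + 3 * k * n1 + 2 * k * n2.
Proof.
move=> kn.
have a0 : (set0 \subset grid n1 n2) && admissible k (set0 : {set pt n1 n2}).
  rewrite sub0set; apply/existsP => -[a /andP[/forallP ha _]].
  have k0 : 0 < k by lia.
  by have := ha (Ordinal k0); rewrite inE.
rewrite /mu (bigop.bigmax_eq_arg set0 a0); case: arg_maxnP => // S /andP[Sg aS] _.
exact: admissible_card_le.
Qed.

(** * Lower bound for [mu] *)

Lemma mu_ge k n1 n2 : 0 < k -> 0 < n1 -> 0 < n2 ->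
  k ^ 2 * (n1 * n2) <= k ^ 2 * mu k n1 n2 + 2 * (n1 * n2).
Proof.
move=> k0 n10 n20.
pose S : {set pt n1 n2} :=
  [set p in grid n1 n2 | 2 * (n1 * n2) < k * (p.1 * n2 + p.2 * n1)].
have Sg : S \subset grid n1 n2 by apply/subsetP => p; rewrite inE => /andP[].
have aS : admissible k S.
  apply/existsP => -[a /and3P[/forallP aS /eqP s1 /eqP s2]].
  (* Both coordinate sums are known, so the right side is exactly [2 * k * (n1 * n2)], which is too
     small. *)
  have : \sum_(i < k) (2 * (n1 * n2)).+1
         <= \sum_(i < k) k * ((a i).1 * n2 + (a i).2 * n1).
    by apply: leq_sum => i _; have := aS i; rewrite inE => /andP[].
  rewrite sum_nat_const card_ord -big_distrr /= big_split /= -!big_distrl /=.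
  by rewrite s1 s2 leq_pmul2l //; lia.
have : #|S| <= mu k n1 n2.
  by apply: (@leq_bigmax_cond _ _ (fun S : {set pt n1 n2} => #|S|)); rewrite Sg.
suff : k ^ 2 * \sum_(1 <= y < n2.+1) gaps (row S y) n1 <= 2 * (n1 * n2).
  by have := card_gaps Sg; nia.
have le_row y : 0 < y <= n2 ->
    k * n2 * gaps (row S y) n1 <= n1 * (2 * n2 - k * y).
  move=> /andP[y0 yn].
  have -> : gaps (row S y) n1 =
      \sum_(1 <= x < n1.+1) (k * y * n1 + k * n2 * x <= 2 * (n1 * n2)).
    apply: eq_big_nat => x /andP[x0 xn].
    rewrite /row !inE /= !inordK ?ltnS // x0 y0 /= -leqNgt.
    by congr (nat_of_bool (_ <= _)); lia.
  apply: leq_trans (count_affine_le _ _ _ _) _; nia.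
have : k * n2 * \sum_(1 <= y < n2.+1) gaps (row S y) n1
    <= n1 * \sum_(1 <= y < n2.+1) (2 * n2 - k * y).
  rewrite !big_distrr /= big_nat_cond [leqRHS]big_nat_cond.
  by apply: leq_sum => y; rewrite andbT; apply: le_row.
have := sum_truncated_le k (2 * n2) n2.
move: (\sum_(_ <= _ < _) gaps _ _) (\sum_(_ <= _ < _) _) => G T hT hG.
have {}hT : 2 * k * T <= (2 * n2) ^ 2 by apply: leq_trans hT; rewrite leq_addr.
rewrite -(leq_pmul2l n20); nia.
Qed.

Local Open Scope ring_scope.

Theorem theorem3p1 (R : realType) (k : nat) (hk : (2 <= k)%N) :
  exists (C : R) (N : nat), forall n1 n2 : nat,
    (0 < n1)%N -> (0 < n2)%N -> (N <= n1)%N -> (N <= n2)%N ->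
    `|nu R k n1 n2 - (k%:R ^+ 2 - 2) / k%:R ^+ 2| <= C * (1 / (minn n1 n2)%:R).
Proof.
(* [5] comes from [3 * k * n1 + 2 * k * n2 <= 5 * k ^ 2 * maxn n1 n2]; [N = k] supplies [k <= n2]
   for [mu_le]. *)
exists 5, k => n1 n2 n10 n20 _ kn.
have k0 : (0 < k)%N by lia.
have lo := mu_ge k0 n10 n20.
have up : (k ^ 2 * mu k n1 n2 + 2 * (n1 * n2)
    <= k ^ 2 * (n1 * n2) + 5 * k ^ 2 * maxn n1 n2)%N.
  have /mu_le : (2 <= k <= n2)%N by rewrite hk.
  move=> /(_ n1); nia.
have mM : (minn n1 n2 * maxn n1 n2 = n1 * n2)%N by lia.
have m0 : (0 < minn n1 n2)%N by lia.
move: lo up; rewrite -(ler_nat R) => lo; rewrite -(ler_nat R) => up.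
rewrite /nu -natrM -mM.
move: lo up; rewrite -mM.
have M0 : (0 < maxn n1 n2)%N by lia.
move: (minn n1 n2) (maxn n1 n2) (mu k n1 n2) m0 M0 => m M s m0 M0.
rewrite !(natrD, natrM, natrX) => lo up.
have kR : (0 : R) < k%:R by rewrite ltr0n.
have mR : (0 : R) < m%:R by rewrite ltr0n.
have MR : (0 : R) < M%:R by rewrite ltr0n.
have D0 : 0 < k%:R ^+ 2 * (m%:R * M%:R) :> R by rewrite !mulr_gt0 ?exprn_gt0.
have -> : s%:R / (m%:R * M%:R) - (k%:R ^+ 2 - 2) / k%:R ^+ 2 =
    (k%:R ^+ 2 * s%:R + 2 * (m%:R * M%:R) - k%:R ^+ 2 * (m%:R * M%:R))
      / (k%:R ^+ 2 * (m%:R * M%:R)) :> R.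
  by field; rewrite !lt0r_neq0.
have -> : 5 * (1 / m%:R) = 5 * k%:R ^+ 2 * M%:R / (k%:R ^+ 2 * (m%:R * M%:R)) :> R.
  by field; rewrite !lt0r_neq0.
(* By [lo] the difference is nonnegative, so only [up] remains to be used. *)
rewrite ger0_norm; last by apply: divr_ge0; [lra | exact: ltW].
by rewrite ler_pM2r ?invr_gt0 //; lra.
Qed.
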